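(* Let $A(x)=\frac{x}{x+1}$, $B(x)=\frac{1}{2-x}$, $C_2(x)=\frac{2x}{x+1}$, regarded as linear fractional transformations of the whole projective line $\mathbb{R}\cup\{\infty\}$ (without restriction of domains), and let $c_2=C_2^{-1}$. The monoid generated by $\{A,B,C_2,c_2\}$ under composition admits a finite complete rewrite system; that is, it is isomorphic to $M(\mathcal{P})$ for some finite complete monoid presentation $\mathcal{P}$.
   Context: A monoid presentation $\mathcal{P}=\langle\Sigma\mid\mathcal{R}\rangle$ consists of a set $\Sigma$ and a set $\mathcal{R}$ of ordered pairs of words in the free monoid $\Sigma^*$; it is finite if $\Sigma$ and $\mathcal{R}$ are finite. $M(\mathcal{P})$ is the quotient of $\Sigma^*$ by the smallest equivalence relation identifying $\alpha r_1\beta$ with $\alpha r_2\beta$ for all $\alpha,\beta\in\Sigma^*$ and $(r_1,r_2)\in\mathcal{R}$. Write $\omega_1\to\omega_2$ if $\omega_1=\alpha r_1\beta$ and $\omega_2=\alpha r_2\beta$ for some $\alpha,\beta\in\Sigma^*$ and $(r_1,r_2)\in\mathcal{R}$. The presentation is complete if this relation is terminating (there is no infinite sequence $\omega_1\to\omega_2\to\omega_3\to\cdots$) and confluent (whenever $\omega$ can be rewritten by finite sequences of $\to$ steps to $\omega'$ and to $\omega''$, there is a word to which both $\omega'$ and $\omega''$ can be rewritten by finite, possibly empty, sequences of $\to$ steps). *)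

(* Defs.v *)
From HB Require Import structures.
From Stdlib Require Import Relation_Definitions Relation_Operators.
From mathcomp Require Import all_boot all_order all_algebra.
From mathcomp Require Import ring.
From mathcomp Require Import boolp classical_sets cardinality reals.

Set Implicit Arguments.
Unset Strict Implicit.
Unset Printing Implicit Defensive.

Import Order.TTheory GRing.Theory Num.Theory.

Local Open Scope classical_set_scope.
Local Open Scope ring_scope.

Definition monoid_isomorphic (M N : monoidType) : Prop :=
  exists f : UMagmaMorphism.type M N, bijective f.

Record presentation := Presentation {
  alphabet : choiceType;
  rules : set (seq alphabet * seq alphabet)
}.
Arguments rules : clear implicits.

Definition finite_presentation (P : presentation) : Prop :=
  finite_set [set: alphabet P] /\ finite_set (rules P).

Definition rewrites (P : presentation) : relation (seq (alphabet P)) :=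
  fun w1 w2 => exists a b r1 r2 : seq (alphabet P),
    [/\ rules P (r1, r2), w1 = a ++ r1 ++ b & w2 = a ++ r2 ++ b].
Arguments rewrites : clear implicits.

Definition terminating (P : presentation) : Prop :=
  ~ exists w : nat -> seq (alphabet P),
      forall n, rewrites P (w n) (w n.+1).

Definition confluent (P : presentation) : Prop :=
  forall w w1 w2 : seq (alphabet P),
    clos_refl_trans _ (rewrites P) w w1 ->
    clos_refl_trans _ (rewrites P) w w2 ->
    exists w3, clos_refl_trans _ (rewrites P) w1 w3 /\
               clos_refl_trans _ (rewrites P) w2 w3.

Definition complete_presentation (P : presentation) : Prop :=
  terminating P /\ confluent P.

Section PresentedMonoid.
Variable P : presentation.
Local Notation word := (seq (alphabet P)).

Definition word_eq : relation word :=
  clos_refl_sym_trans word (rewrites P).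

Definition word_eqb (u v : word) : bool := `[< word_eq u v >].

Lemma word_eqb_refl : reflexive word_eqb.
Proof. by move=> u; apply/asboolP; apply: rst_refl. Qed.

Lemma word_eqb_sym : symmetric word_eqb.
Proof. by move=> u v; apply/asboolP/asboolP; apply: rst_sym. Qed.

Lemma word_eqb_trans : transitive word_eqb.
Proof.
by move=> v u w /asboolP uv /asboolP vw; apply/asboolP; apply: rst_trans uv vw.
Qed.

Canonical word_eq_equiv :=
  EquivRel word_eqb word_eqb_refl word_eqb_sym word_eqb_trans.

Lemma word_eq_cat (u1 v1 u2 v2 : word) :
  word_eq u1 v1 -> word_eq u2 v2 -> word_eq (u1 ++ u2) (v1 ++ v2).
Proof.
have catr (w u v : word) : word_eq u v -> word_eq (u ++ w) (v ++ w).
  elim=> [x y [a [b [r1 [r2 [Pr -> ->]]]]]|x|x y _|x y z _ + _].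
  - by apply: rst_step; exists a, (b ++ w), r1, r2; rewrite -!catA.
  - exact: rst_refl.
  - exact: rst_sym.
  - exact: rst_trans.
have catl (w u v : word) : word_eq u v -> word_eq (w ++ u) (w ++ v).
  elim=> [x y [a [b [r1 [r2 [Pr -> ->]]]]]|x|x y _|x y z _ + _].
  - by apply: rst_step; exists (w ++ a), b, r1, r2; rewrite -!catA.
  - exact: rst_refl.
  - exact: rst_sym.
  - exact: rst_trans.
by move=> h1 h2; apply: rst_trans (catr u2 _ _ h1) (catl v1 _ _ h2).
Qed.

Definition presented_monoid : Type := {eq_quot word_eq_equiv}%qT.
HB.instance Definition _ := Choice.on presented_monoid.

Definition word_class (w : word) : presented_monoid :=
  (\pi_{eq_quot word_eq_equiv} w)%qT.

Definition class_repr (x : presented_monoid) : word :=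
  repr (x : {eq_quot word_eq_equiv}%qT).

Definition presented_mul (x y : presented_monoid) : presented_monoid :=
  word_class (class_repr x ++ class_repr y).

Definition presented_one : presented_monoid := word_class [::].

Lemma class_reprK : cancel class_repr word_class.
Proof. by move=> x; rewrite /word_class /class_repr reprK. Qed.

Lemma word_classP (u v : word) : word_class u = word_class v <-> word_eq u v.
Proof.
split=> [/eqmodP/asboolP //|uv].
by apply/eqmodP/asboolP.
Qed.

Lemma word_class_cat (u v : word) :
  presented_mul (word_class u) (word_class v) = word_class (u ++ v).
Proof.
by apply/word_classP/word_eq_cat; apply/word_classP; rewrite class_reprK.
Qed.

Lemma presented_mulA : associative presented_mul.
Proof.
move=> x y z; rewrite -(class_reprK x) -(class_reprK y) -(class_reprK z).
by rewrite !word_class_cat catA.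
Qed.

Lemma presented_mul1m : left_id presented_one presented_mul.
Proof. by move=> x; rewrite -(class_reprK x) word_class_cat. Qed.

Lemma presented_mulm1 : right_id presented_one presented_mul.
Proof. by move=> x; rewrite -(class_reprK x) word_class_cat cats0. Qed.

HB.instance Definition _ := isMonoid.Build presented_monoid
  presented_mulA presented_mul1m presented_mulm1.

End PresentedMonoid.

Section SelfMap.
Variable T : choiceType.

Definition selfmap : Type := T -> T.
HB.instance Definition _ := Choice.on selfmap.

Definition selfmap_comp (f g : selfmap) : selfmap := f \o g.
Definition selfmap_id : selfmap := id.

Lemma selfmap_compA : associative selfmap_comp. Proof. by []. Qed.
Lemma selfmap_comp1f : left_id selfmap_id selfmap_comp. Proof. by []. Qed.
Lemma selfmap_compf1 : right_id selfmap_id selfmap_comp. Proof. by []. Qed.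

HB.instance Definition _ := isMonoid.Build selfmap
  selfmap_compA selfmap_comp1f selfmap_compf1.
End SelfMap.

Section Generated.
Variables (G : monoidType) (S : set G).

Inductive generated : G -> Prop :=
  | generated_one : generated 1%g
  | generated_gen x of S x : generated x
  | generated_mul x y of generated x & generated y : generated (x * y)%g.

Definition generated_pred : pred G := fun x => `[< generated x >].

Lemma generated_pred_closed : monoid_closed generated_pred.
Proof.
split=> [|x y /asboolP gx /asboolP gy]; apply/asboolP.
- exact: generated_one.
- exact: generated_mul.
Qed.

Definition generated_monoid : Type := {x : G | generated_pred x}.
HB.instance Definition _ := SubChoice.on generated_monoid.
HB.instance Definition _ :=
  SubChoice_isSubMonoid.Build G generated_pred generated_monoid
    generated_pred_closed.

End Generated.

Section LinearFractional.
Variable R : realType.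

(* [None] is the point at infinity. *)
Definition projline : Type := option R.
HB.instance Definition _ := Choice.on projline.

(* x |-> (a x + b) / (c x + d); the determinant a d - b c is meant to be
   nonzero, so that numerator and denominator never vanish together. *)
Definition lft (a b c d : R) : selfmap projline := fun x : option R =>
  match x with
  | Some t => if c * t + d == 0 then None
              else Some ((a * t + b) / (c * t + d))
  | None => if c == 0 then None else Some (a / c)
  end.

Definition lft_A : selfmap projline := lft 1 0 1 1.
Definition lft_B : selfmap projline := lft 0 1 (-1) 2.
Definition lft_C2 : selfmap projline := lft 2 0 1 1.

(* y = 2x/(x+1) solves to x = y/(2-y). *)
Definition lft_c2 : selfmap projline := lft 1 0 (-1) 2.

Lemma lft_C2K : cancel lft_C2 lft_c2.
Proof.
have n2 : 2 != 0 :> R by rewrite pnatr_eq0.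
have n1 : -1 != 0 :> R by rewrite oppr_eq0 oner_eq0.
rewrite /lft_C2 /lft_c2 /lft => -[t|].
  rewrite !(mul1r, addr0); case: eqP => [t1|/eqP t1].
    rewrite (negPf n1); congr Some.
    by rewrite invrN1 -(addr0_eq t1) opprK.
  have -> : -1 * (2 * t / (t + 1)) + 2 = 2 / (t + 1) by field.
  by rewrite mulf_eq0 invr_eq0 (negPf n2) (negPf t1); congr Some; field;
    rewrite ?t1 ?n2.
by rewrite oner_eq0 divr1 mulN1r addNr eqxx.
Qed.

Lemma lft_c2K : cancel lft_c2 lft_C2.
Proof.
have n2 : 2 != 0 :> R by rewrite pnatr_eq0.
have n1 : -1 != 0 :> R by rewrite oppr_eq0 oner_eq0.
rewrite /lft_C2 /lft_c2 /lft => -[t|].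
  rewrite !(mul1r, addr0); case: eqP => [t1|/eqP t1].
    rewrite oner_eq0; congr Some.
    by rewrite divr1; apply/eqP; rewrite -subr_eq0 -mulN1r addrC t1.
  rewrite !(mul1r, addr0).
  have -> : t / (-1 * t + 2) + 1 = 2 / (-1 * t + 2) by field.
  by rewrite mulf_eq0 invr_eq0 (negPf n2) (negPf t1); congr Some; field;
    rewrite ?t1 ?n2.
by rewrite (negPf n1) mul1r invrN1 mulrN1 addNr eqxx.
Qed.

End LinearFractional.

Arguments lft_A : clear implicits.
Arguments lft_B : clear implicits.
Arguments lft_C2 : clear implicits.
Arguments lft_c2 : clear implicits.

(* Main.v *)
Require Import Defs.
From HB Require Import structures.
From Stdlib Require Import Relation_Operators.
From mathcomp Require Import all_boot all_order all_algebra.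
From mathcomp Require Import ring lra zify.
From mathcomp Require Import boolp classical_sets cardinality reals.

Set Implicit Arguments.
Unset Strict Implicit.
Unset Printing Implicit Defensive.

Import Order.TTheory GRing.Theory Num.Theory.

Local Open Scope classical_set_scope.

(* Write c for c2 and C for C2. On [0, 1] the maps C, c act on the expansions
   in A, B by the transducer C AA = A C, C AB = B A c, C B = B B C (and the
   images under A <-> B, C <-> c); these relations, with C c = c C = 1, oriented
   from left to right, push C and c to the right and terminate by a linear
   interpretation. Confluence and faithfulness both follow once irreducible
   words with the same map are shown to be equal. The integer matrix of an
   irreducible word is nonzero modulo 2 and has determinant 2^h, where h is the
   number of letters C, c, so the map determines h. If two irreducible words
   start with A or B, the images of 1/2 show that they start with the same
   letter, which cancels; if one of them is C u and the other v, then u and the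
   normal form of c v have the same map and u has fewer letters C, c. *)

(* [Par false], [Par true], [Hyp false], [Hyp true] stand for the maps A, B, C2,
   c2 (parabolic and hyperbolic); conjugation by x |-> 1 - x flips the boolean. *)
Notation letter := (bool * bool)%type.
Notation Par b := (false, b).
Notation Hyp b := (true, b).
Notation word := (seq letter).

(** * The rewriting system *)

Definition lft_rules_at (b : bool) : seq (word * word) :=
  [:: ([:: Hyp b; Hyp (~~ b)], [::]);
      ([:: Hyp b; Par b; Par b], [:: Par b; Hyp b]);
      ([:: Hyp b; Par b; Par (~~ b)], [:: Par (~~ b); Par b; Hyp (~~ b)]);
      ([:: Hyp b; Par (~~ b)], [:: Par (~~ b); Par (~~ b); Hyp b])].

Definition lft_rules : seq (word * word) :=
  lft_rules_at false ++ lft_rules_at true.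

Definition lft_presentation : presentation :=
  @Presentation letter [set` lft_rules].

Notation step := (rewrites lft_presentation).
Notation steps := (clos_refl_trans _ step).

Lemma lft_rulesP (l r : word) :
  (l, r) \in lft_rules -> exists b, (l, r) \in lft_rules_at b.
Proof. by rewrite mem_cat => /orP[]; [exists false|exists true]. Qed.

Lemma mem_lft_rules b p : p \in lft_rules_at b -> p \in lft_rules.
Proof. by rewrite mem_cat => pb; case: b pb => ->; rewrite ?orbT. Qed.

Lemma lft_rules_ind (Q : word -> word -> Prop) :
  (forall b, [/\ Q [:: Hyp b; Hyp (~~ b)] [::],
      Q [:: Hyp b; Par b; Par b] [:: Par b; Hyp b],
      Q [:: Hyp b; Par b; Par (~~ b)] [:: Par (~~ b); Par b; Hyp (~~ b)]
    & Q [:: Hyp b; Par (~~ b)] [:: Par (~~ b); Par (~~ b); Hyp b]]) ->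
  forall l r, (l, r) \in lft_rules -> Q l r.
Proof.
move=> hQ l r /lft_rulesP[b]; have [q1 q2 q3 q4] := hQ b.
by rewrite !inE => /or4P[] /eqP[-> ->].
Qed.

Lemma finite_lft_presentation : finite_presentation lft_presentation.
Proof. by split; [exact: finite_finset|exact: finite_seq]. Qed.

Lemma stepP (u v : word) : step u v ->
  exists a b l r : word,
    [/\ (l, r) \in lft_rules, u = a ++ l ++ b & v = a ++ r ++ b].
Proof. by []. Qed.

Lemma step_rule (b : bool) (l r w : word) :
  (l, r) \in lft_rules_at b -> step (l ++ w) (r ++ w).
Proof.
by move=> lr; exists [::], w, l, r; split=> //; exact: mem_lft_rules lr.
Qed.

Lemma step_cons (x : letter) (u v : word) : step u v -> step (x :: u) (x :: v).
Proof. by move=> [a [b [l [r [lr -> ->]]]]]; exists (x :: a), b, l, r. Qed.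

(** * Termination *)

(** Slope 2 would not do: before a word of weight n, [[:: Hyp b; Par (~~ b)]] weighs 3n+4 and its
    replacement 3n+3, but slope 2 would make them tie. *)
Definition weight : word -> nat :=
  foldr (fun x n => if x.1 then (3 * n).+1 else n.+1) 0.

Lemma weight_step (u v : word) : step u v -> weight v < weight u.
Proof.
move=> /stepP[a [b [l [r [lr -> ->]]]]].
(* Every letter acts by a strictly increasing function, so the left context drops out. *)
elim: a => [|x a IHa] /=; last by case: x.1; lia.
move: l r lr; apply: lft_rules_ind => c.
by split; case: c => /=; lia.
Qed.

Lemma terminating_lft : terminating lft_presentation.
Proof.
move=> [w hw]; have lew n : n + weight (w n) <= weight (w 0).
  by elim: n => [|n IHn] //; have := weight_step (hw n); lia.
by have := lew (weight (w 0)).+1; lia.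
Qed.

(** * Irreducible words *)

(** Tests that no left-hand side is a prefix of [x :: w]: [Hyp b] may be followed only by nothing,
    by [Hyp b], or by a [Par b] that is last or precedes a [Hyp]. *)
Definition irr_head (x : letter) (w : word) : bool :=
  if x.1 then
    if w is y :: w' then
      (y.2 == x.2) && (y.1 || if w' is z :: _ then z.1 else true)
    else true
  else true.

(** Such a word is a string of [Par] letters, then blocks of equal letters [Hyp b], each closed by a
    single [Par b] that the last block may lack. *)
Fixpoint irr (w : word) : bool :=
  if w is x :: w' then irr_head x w' && irr w' else true.

Lemma irrPn (w : word) : ~~ irr w -> exists v, step w v.
Proof.
elim: w => // x w IHw /=; rewrite negb_and orbC => /orP[/IHw[v wv]|].
  by exists (x :: v); exact: step_cons.
case: x => -[] b //=; case: w {IHw} => // -[[] b'] w; rewrite /irr_head /=.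
  rewrite andbT; case: (eqVneq b' b) => // b'b _.
  exists w; apply: (@step_rule b [:: Hyp b; Hyp b'] [::] w).
  by case: b b' b'b => -[].
case: (eqVneq b' b) => [->{b'}|b'b _] /=; last first.
  exists [:: Par b', Par b', Hyp b & w].
  apply: (@step_rule b [:: Hyp b; Par b'] [:: Par b'; Par b'; Hyp b] w).
  by case: b b' b'b => -[].
case: w => // -[[] b'] w //= _; case: (eqVneq b' b) => [->{b'}|b'b].
  exists [:: Par b, Hyp b & w].
  apply: (@step_rule b [:: Hyp b; Par b; Par b] [:: Par b; Hyp b] w).
  by case: b.
exists [:: Par b', Par b, Hyp b' & w].
apply: (@step_rule b [:: Hyp b; Par b; Par b'] [:: Par b'; Par b; Hyp b'] w).
by case: b b' b'b => -[].
Qed.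

Lemma irr_normal_form (w : word) : exists2 n, irr n & steps w n.
Proof.
have [k] := ubnP (weight w); elim: k w => // k IHk w lewk.
have [iw|/irrPn[v wv]] := boolP (irr w).
  by exists w => //; exact: rt_refl.
have [|n nv vn] := IHk v; first by have := weight_step wv; lia.
by exists n => //; apply: rt_trans vn; exact: rt_step.
Qed.

(** * Integer matrices *)

Local Open Scope ring_scope.

Notation mat2 := (int * int * int * int)%type.

Definition mat2_mul (m n : mat2) : mat2 :=
  let: (a, b, c, d) := m in let: (p, q, r, s) := n in
  (a * p + b * r, a * q + b * s, c * p + d * r, c * q + d * s).

Definition mat2_det (m : mat2) : int := let: (a, b, c, d) := m in a * d - b * c.

Definition mat2_letter (x : letter) : mat2 :=
  match x with
  | Par false => (1, 0, 1, 1)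
  | Par true => (0, 1, -1, 2)
  | Hyp false => (2, 0, 1, 1)
  | Hyp true => (1, 0, -1, 2)
  end.

Definition mat2_word (w : word) : mat2 :=
  foldr (fun x m => mat2_mul (mat2_letter x) m) (1, 0, 0, 1) w.

Lemma mat2_word_cons (x : letter) (w : word) :
  mat2_word (x :: w) = mat2_mul (mat2_letter x) (mat2_word w).
Proof. by []. Qed.

Definition hcount (w : word) : nat := count (fun x => x.1) w.

Lemma mat2_det_word (w : word) : mat2_det (mat2_word w) = 2 ^+ hcount w.
Proof.
elim: w => // x w; rewrite /hcount /= exprD => <-.
case: (mat2_word w) => -[[p q] r] s.
by case: x => -[] [] /=; ring.
Qed.

Definition oddz (a : int) : bool := odd `|a|%N.

Lemma oddzD (a b : int) : oddz (a + b) = oddz a (+) oddz b.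
Proof. by rewrite /oddz; lia. Qed.

Lemma oddzM (a b : int) : oddz (a * b) = oddz a && oddz b.
Proof. by rewrite /oddz abszM oddM. Qed.

Definition mat2_odd (m : mat2) : bool :=
  let: (a, b, c, d) := m in [|| oddz a, oddz b, oddz c | oddz d].

(* Reduction modulo 2: the column space is spanned by (0, 1) after an initial
   C2 and by (1, 1) after an initial c2. *)
Definition mat2_shape (b : bool) (m : mat2) : bool :=
  let: (p, q, r, s) := m in
  if b then [&& oddz p == oddz r, oddz q == oddz s & oddz p || oddz q]
  else [&& ~~ oddz p, ~~ oddz q & oddz r || oddz s].

(** Modulo 2, C2 kills only (1, 1) and c2 only (0, 1), each the image of the other. A repeated
    letter therefore survives. So does a single [Par b] in between: A sends (0, 1) and (1, 1) to (0,
    1) and (1, 0), and B sends them to (1, 0) and (1, 1). *)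
Lemma mat2_shape_irr (b : bool) (w : word) :
  irr (Hyp b :: w) -> mat2_shape b (mat2_word (Hyp b :: w)).
Proof.
have [k] := ubnP (size w); elim: k b w => // k IHk b [|[[] b1] w] lewk.
- by case: b.
- move=> /andP[/andP[/eqP b1b _] irrw]; rewrite /= in b1b; subst b1.
  have := IHk b w lewk irrw; rewrite (mat2_word_cons _ (_ :: _)).
  case: (mat2_word (Hyp b :: w)) => -[[p q] r] s.
  case: b {irrw IHk lewk}; rewrite /= !(oddzD, oddzM) /=;
  by case: (oddz p) (oddz q) (oddz r) (oddz s) => -[] [] [].
move=> /andP[/andP[/eqP b1b irrbw] irrw]; rewrite /= in b1b; subst b1.
case: w lewk irrw irrbw => [_ _ _|[[] b2] w lewk irrw _] //.
  by case: b.
have := IHk b2 w (ltnW lewk) irrw; rewrite !(mat2_word_cons _ (_ :: _)).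
case: (mat2_word (Hyp b2 :: w)) => -[[p q] r] s.
case: b {lewk irrw IHk}; case: b2; rewrite /= !(oddzD, oddzM) /=;
by case: (oddz p) (oddz q) (oddz r) (oddz s) => -[] [] [].
Qed.

(** A and B are invertible modulo 2, so leading [Par] letters are harmless. *)
Lemma mat2_odd_irr (w : word) : irr w -> mat2_odd (mat2_word w).
Proof.
elim: w => // -[[] b] w IHw irrw.
  have := mat2_shape_irr irrw.
  case: (mat2_word _) => -[[p q] r] s.
  rewrite /=; case: {irrw} b => /=;
  by case: (oddz p) (oddz q) (oddz r) (oddz s) => -[] [] [].
move: IHw; rewrite mat2_word_cons.
case: (mat2_word w) => -[[p q] r] s /(_ irrw).
case: {irrw} b; rewrite /= !(oddzD, oddzM) /=;
by case: (oddz p) (oddz q) (oddz r) (oddz s) => -[] [] [].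
Qed.

(** * Evaluation of words *)

Section Evaluation.
Variable R : realType.

Definition lft_letter (x : letter) : selfmap (projline R) :=
  match x with
  | Par false => lft_A R
  | Par true => lft_B R
  | Hyp false => lft_C2 R
  | Hyp true => lft_c2 R
  end.

(** The first letter acts last, hence can be read off from the image. *)
Definition lft_word (w : word) : selfmap (projline R) :=
  foldr (fun x f => lft_letter x * f)%g 1%g w.

Definition lft_mat2 (m : mat2) : selfmap (projline R) :=
  let: (p, q, r, s) := m in lft p%:~R q%:~R r%:~R s%:~R.

Lemma selfmap_eq (t : projline R) (f g : selfmap (projline R)) :
  f = g -> f t = g t.
Proof. by move=> ->. Qed.

Lemma lft_word_cat (u v : word) :
  lft_word (u ++ v) = (lft_word u * lft_word v)%g.
Proof. by elim: u => [|x u IHu] /=; rewrite ?mul1g // IHu mulgA. Qed.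

(** At a pole of the inner map the nonzero determinant keeps its numerator nonzero, so the point at
    infinity is passed on correctly. *)
Lemma lft_comp (a b c d p q r s : R) : p * s - q * r != 0 ->
  lft a b c d \o lft p q r s =
  lft (a * p + b * r) (a * q + b * s) (c * p + d * r) (c * q + d * s).
Proof.
move=> det_neq0; apply/funext => -[t|] /=.
  have -> : (c * p + d * r) * t + (c * q + d * s) =
            c * (p * t + q) + d * (r * t + s) by ring.
  have -> : (a * p + b * r) * t + (a * q + b * s) =
            a * (p * t + q) + b * (r * t + s) by ring.
  have [rt0|rt_neq0] := eqVneq (r * t + s) 0 => /=.
    have pt_neq0 : p * t + q != 0.
      apply: contraNneq det_neq0 => pt0.
      have sE : s = - (r * t) by apply/eqP; rewrite -addr_eq0 addrC rt0.
      have qE : q = - (p * t) by apply/eqP; rewrite -addr_eq0 addrC pt0.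
      by rewrite sE qE; apply/eqP; ring.
    rewrite rt0 !mulr0 !addr0 mulf_eq0 (negPf pt_neq0) orbF.
    by case: eqP => // /eqP c0; congr Some; field; rewrite c0 pt_neq0.
  have -> : c * ((p * t + q) / (r * t + s)) + d =
            (c * (p * t + q) + d * (r * t + s)) / (r * t + s) by field.
  rewrite mulf_eq0 invr_eq0 (negPf rt_neq0) orbF.
  by case: eqP => // /eqP c0; congr Some; field; rewrite c0 rt_neq0.
have [r0|r_neq0] := eqVneq r 0 => /=.
  have p_neq0 : p != 0.
    by apply: contraNneq det_neq0 => p0; rewrite p0 r0 mul0r mulr0 subr0.
  rewrite r0 !mulr0 !addr0 mulf_eq0 (negPf p_neq0) orbF.
  by case: eqP => // /eqP c0; congr Some; field; rewrite c0 p_neq0.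
have -> : c * (p / r) + d = (c * p + d * r) / r by field.
rewrite mulf_eq0 invr_eq0 (negPf r_neq0) orbF.
by case: eqP => // /eqP c0; congr Some; field; rewrite c0 r_neq0.
Qed.

Lemma lft_letter_mat2 x : lft_letter x = lft_mat2 (mat2_letter x).
Proof. by case: x => -[] []; rewrite /lft_mat2 /= ?rmorphN1. Qed.

Lemma lft1 : lft 1 0 0 1 = id :> selfmap (projline R).
Proof.
apply/funext => -[t|] /=; last by rewrite eqxx.
by rewrite mul0r add0r oner_eq0 divr1 mul1r addr0.
Qed.

Lemma lft_word_mat2 (w : word) : lft_word w = lft_mat2 (mat2_word w).
Proof.
elim: w => [|x w IHw]; first by rewrite /lft_mat2 /= lft1.
rewrite mat2_word_cons [LHS]/= IHw lft_letter_mat2.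
have : mat2_det (mat2_word w) != 0 by rewrite mat2_det_word expf_neq0.
case: (mat2_word w) => -[[p q] r] s; case: (mat2_letter x) => -[[a b] c] d.
rewrite /mat2_det /lft_mat2 /mat2_mul => det_neq0.
rewrite [LHS]lft_comp; first by rewrite !(rmorphD, rmorphM).
by rewrite -!rmorphM -rmorphB intr_eq0.
Qed.

Lemma lft_A_inj : injective (lft_A R).
Proof.
(* The inverse is given by the adjugate matrix, here and for B. *)
have AK : lft 1 0 (-1) 1 \o lft_A R = id.
  rewrite lft_comp; last by rewrite mul0r mulr1 subr0 oner_eq0.
  by rewrite -lft1; congr lft; ring.
by apply: (can_inj (g := lft 1 0 (-1) 1)) => x; exact (selfmap_eq x AK).
Qed.

Lemma lft_B_inj : injective (lft_B R).
Proof.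
have BK : lft 2 (-1) 1 0 \o lft_B R = id.
  rewrite lft_comp; last by rewrite mul0r mul1r sub0r opprK oner_eq0.
  by rewrite -lft1; congr lft; ring.
by apply: (can_inj (g := lft 2 (-1) 1 0)) => x; exact (selfmap_eq x BK).
Qed.

Lemma lft_letter_inj x : injective (lft_letter x).
Proof.
case: x => -[] []; [exact: can_inj (@lft_c2K R)|exact: can_inj (@lft_C2K R)|..].
- exact: lft_B_inj.
- exact: lft_A_inj.
Qed.

Lemma lft_word_cons_inj (x : letter) (u v : word) :
  lft_word (x :: u) = lft_word (x :: v) -> lft_word u = lft_word v.
Proof.
move=> /= xuv; apply/funext => t; apply: (@lft_letter_inj x).
exact (selfmap_eq t xuv).
Qed.

Lemma lft_word_HypK (b : bool) (w : word) :
  lft_word [:: Hyp b, Hyp (~~ b) & w] = lft_word w.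
Proof.
apply/funext => t; case: b; first exact: lft_C2K.
exact: lft_c2K.
Qed.

Lemma lft_word_step (u v : word) : step u v -> lft_word u = lft_word v.
Proof.
move=> /stepP[a [b [l [r [lr -> ->]]]]]; rewrite !lft_word_cat.
congr (_ * (_ * _))%g; move: l r lr; apply: lft_rules_ind => c; split.
- exact: lft_word_HypK.
(* These three rules are equalities of integer matrices; the cancelling rule is one only up to the
   scalar 2. *)
- by rewrite !lft_word_mat2; case: c.
- by rewrite !lft_word_mat2; case: c.
- by rewrite !lft_word_mat2; case: c.
Qed.

Lemma lft_word_steps (u v : word) : steps u v -> lft_word u = lft_word v.
Proof.
by elim=> {u v} [u v /lft_word_step||u v w _ -> _ ->].
Qed.

Lemma lft_word_eq (u v : word) :
  word_eq (P := lft_presentation) u v -> lft_word u = lft_word v.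
Proof.
by elim=> {u v} [u v /lft_word_step|//|u v _ ->|u v w _ -> _ ->].
Qed.

(** * Ping-pong on the open unit interval *)

Lemma lft_letter_unit (x : letter) (t : R) : 0 < t < 1 ->
  exists t', [/\ 0 < t' < 1, lft_letter x (Some t) = Some t'
    & ~~ x.1 -> if x.2 then 2^-1 < t' else t' < 2^-1].
Proof.
move=> /andP[t0 t1].
have tD0 : 0 < t + 1 by lra.
have tB0 : 0 < 2 - t by lra.
case: x => -[] [] /=;
  rewrite !(mul1r, mulN1r, mul0r, add0r, addr0) ?[- t + 2]addrC.
- rewrite (gt_eqF tB0); exists (t / (2 - t)); split=> //.
  by rewrite divr_gt0 // ltr_pdivrMr //; lra.
- rewrite (gt_eqF tD0); exists (2 * t / (t + 1)); split=> //.
  by rewrite divr_gt0 ?ltr_pdivrMr //; lra.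
- rewrite (gt_eqF tB0); exists (2 - t)^-1; split=> // [|_].
    by rewrite invr_gt0 tB0 invf_lt1 //; lra.
  by rewrite ltf_pV2 ?qualifE //=; lra.
- rewrite (gt_eqF tD0); exists (t / (t + 1)); split=> // [|_].
    by rewrite divr_gt0 // ltr_pdivrMr //; lra.
  by rewrite ltr_pdivrMr //; lra.
Qed.

Lemma lft_word_half (w : word) :
  exists2 t : R, 0 < t < 1 & lft_word w (Some 2^-1) = Some t.
Proof.
elim: w => [|x w [t t01 wt]]; first by exists 2^-1 => //=; lra.
have [t' [t'01 xt _]] := lft_letter_unit x t01; exists t' => //.
by rewrite -xt -wt.
Qed.

Lemma lft_word_half_Par (b : bool) (w : word) :
  exists2 t : R, (if b then 2^-1 < t else t < 2^-1)
    & lft_word (Par b :: w) (Some 2^-1) = Some t.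
Proof.
have [t t01 wt] := lft_word_half w.
have [t' [_ xt /(_ isT) bt]] := lft_letter_unit (Par b) t01; exists t' => //.
by rewrite -xt -wt.
Qed.

(** The identity fixes 1/2, while A and B push the image strictly to one side of it. *)
Lemma lft_word_Par_neq1 (b : bool) (w : word) :
  lft_word (Par b :: w) <> lft_word [::].
Proof.
move=> eqw; have [t + wt] := lft_word_half_Par b w.
by move: wt; rewrite eqw => -[<-]; case: b {eqw}; rewrite ltxx.
Qed.

Lemma lft_word_Par_head (b c : bool) (u v : word) :
  lft_word (Par b :: u) = lft_word (Par c :: v) -> b = c.
Proof.
move=> eqw; have [t + ut] := lft_word_half_Par b u.
have [t' + vt] := lft_word_half_Par c v.
move: ut; rewrite eqw vt => -[->].
by case: b c {eqw vt} => -[] // lt1 lt2; have := lt_trans lt1 lt2; rewrite ltxx.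
Qed.

(** * Equal maps and the number of hyperbolic letters *)

(** Evaluation at infinity, 0 and 1. Together the equations say that the adjugate of the first
    matrix times the second is scalar. *)
Lemma lft_eq_cross (p q r s p' q' r' s' : R) :
  lft p q r s = lft p' q' r' s' ->
  [/\ p * r' = p' * r, q * s' = q' * s
    & (p + q) * (r' + s') = (p' + q') * (r + s)].
Proof.
have frac_eq (a b c d : R) :
  (if b == 0 then None else Some (a / b)) =
  (if d == 0 then None else Some (c / d)) -> a * d = c * b.
  have [->|b0] := eqVneq b 0; have [->|d0] := eqVneq d 0 => //.
    by rewrite !mulr0.
  by move=> [/eqP]; rewrite eqr_div // => /eqP.
move=> eqlft; split.
- exact/frac_eq/(selfmap_eq None eqlft).
- by have /frac_eq := selfmap_eq (Some 0) eqlft; rewrite !mulr0 !add0r.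
- by have /frac_eq := selfmap_eq (Some 1) eqlft; rewrite !mulr1.
Qed.

(* [k] is the scalar adj(M u) * M v; comparing 2^(hcount u) * M v = k * M u at
   an odd entry of M u gives 2^(hcount u) | k, while
   k^2 = 2^(hcount u + hcount v). *)
Lemma leq_hcount (u v : word) :
  irr u -> lft_word u = lft_word v -> (hcount u <= hcount v)%N.
Proof.
move=> irru; rewrite !lft_word_mat2.
have := mat2_odd_irr irru.
have := mat2_det_word u; have := mat2_det_word v.
case: (mat2_word u) => -[[p q] r] s; case: (mat2_word v) => -[[p' q'] r'] s'.
rewrite /lft_mat2 /mat2_det /= => detv detu oddu.
move=> /lft_eq_cross[]; rewrite -!rmorphM -!rmorphD -!rmorphM.
move=> /intr_inj /eqP e1 /intr_inj /eqP e2 /intr_inj /eqP e3.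
rewrite -subr_eq0 in e1; rewrite -subr_eq0 in e2; rewrite -subr_eq0 in e3.
pose k := s * p' - q * r'.
(* The two diagonal entries of the adjugate product agree. *)
have kE : k = p * s' - r * q'.
  apply/eqP; rewrite -subr_eq0.
  have -> : k - (p * s' - r * q') =
    (p * r' - p' * r) + (q * s' - q' * s)
    - ((p + q) * (r' + s') - (p' + q') * (r + s)) by rewrite /k; ring.
  by rewrite (eqP e1) (eqP e2) (eqP e3) subr0 addr0.
have kk : k * k = 2 ^+ (hcount u + hcount v).
  rewrite exprD -detu -detv {2}kE; apply/eqP; rewrite -subr_eq0.
  have -> : k * (p * s' - r * q') - (p * s - q * r) * (p' * s' - q' * r') =
    (s * q' - q * s') * (p * r' - p' * r) by rewrite /k; ring.
  by rewrite (eqP e1) mulr0.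
(* An odd entry is coprime to the power of 2, which must then divide [k]. *)
have kM (a a' : int) : (p * s - q * r) * a' = k * a -> oddz a ->
    (2 ^+ hcount u %| k)%Z.
  rewrite detu => ka odda; rewrite -(@Gauss_dvdzl _ _ a).
    by rewrite -ka dvdz_mulr.
  by rewrite coprimezE abszX coprimeXl ?coprime2n.
have {kM} dvdk : (2 ^+ hcount u %| k)%Z.
  case/or4P: oddu; [apply: (kM p p')|apply: (kM q q')|apply: (kM r r')|
    apply: (kM s s')]; apply/eqP; rewrite -subr_eq0.
  - have -> : (p * s - q * r) * p' - k * p = q * (p * r' - p' * r)
      by rewrite /k; ring.
    by rewrite (eqP e1) mulr0.
  - have -> : (p * s - q * r) * q' - k * q = - p * (q * s' - q' * s)
      by rewrite kE; ring.
    by rewrite (eqP e2) mulr0.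
  - have -> : (p * s - q * r) * r' - k * r = s * (p * r' - p' * r)
      by rewrite /k; ring.
    by rewrite (eqP e1) mulr0.
  - have -> : (p * s - q * r) * s' - k * s = - r * (q * s' - q' * s)
      by rewrite kE; ring.
    by rewrite (eqP e2) mulr0.
have : (2 ^+ hcount u * 2 ^+ hcount u %| k * k)%Z by exact: dvdz_mul.
by rewrite kk -exprD dvdzE !abszX dvdn_Pexp2l // leq_add2l.
Qed.

Lemma hcount_eq (u v : word) :
  irr u -> irr v -> lft_word u = lft_word v -> hcount u = hcount v.
Proof. by move=> iu iv uv; apply/eqP; rewrite eqn_leq !leq_hcount. Qed.

(** * Uniqueness of irreducible words *)

Lemma irr_uniq (u v : word) :
  irr u -> irr v -> lft_word u = lft_word v -> u = v.
Proof.
have [k] := ubnP (hcount u); elim: k u v => // k IHk.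
have headHyp b u v : (hcount (Hyp b :: u) < k.+1)%N ->
    irr (Hyp b :: u) -> irr v ->
    lft_word (Hyp b :: u) = lft_word v -> Hyp b :: u = v.
  have negE (x y : bool) : x != y -> x = ~~ y by case: x y => -[].
  move=> lek irrbu irrv buv; have /andP[hbu irru] := irrbu.
  have cbuv := hcount_eq irrbu irrv buv.
  have ltk : (hcount u < k)%N by [].
  have uE : lft_word u = lft_word (Hyp (~~ b) :: v).
    apply: (@lft_word_cons_inj (Hyp b)).
    by rewrite lft_word_HypK.
  (* Otherwise [u] would have one hyperbolic letter more than [v], but it has one fewer. *)
  have longv : ~~ irr (Hyp (~~ b) :: v).
    apply/negP => irrv'; have := hcount_eq irru irrv' uE.
    by move: cbuv; rewrite /hcount /=; lia.
  (* One rewriting step at the head exposes a parabolic prefix [r]. Putting it before a normal form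
     of the rest keeps the word irreducible, so induction identifies this word with [u]. *)
  have red c (l r s w : word) : (l, r ++ s) \in lft_rules_at c ->
      Hyp (~~ b) :: v = l ++ w -> all (fun x => ~~ x.1) r ->
      exists n, u = r ++ n.
    move=> lr vE allr; have [n irrn swn] := irr_normal_form (s ++ w).
    exists n; apply: IHk => //.
      by elim: r allr {lr} => //= -[[] c'] r IHr //= /IHr.
    rewrite uE vE (lft_word_step (step_rule w lr)) -catA.
    by rewrite !(lft_word_cat r) (lft_word_steps swn).
  move: longv; rewrite [irr _]/= irrv andbT.
  case: v irrv buv cbuv uE red => [|[[] c] v] // irrv buv cbuv uE red.
    rewrite /irr_head /= andbT; have [cb|cb] := eqVneq c b; last first.
      by rewrite (negE _ _ cb) eqxx.
    subst c => _; congr (_ :: _); apply: IHk => //; first by case/andP: irrv.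
    by rewrite uE -{2}[b]negbK lft_word_HypK.
  (* In each remaining case the prefix forced on [u] completes a left-hand side after [Hyp b],
     contradicting irreducibility of [Hyp b :: u]. *)
  rewrite /irr_head /=; have [cb|cb] := eqVneq c b; first subst c.
    move=> _; have [|||n uE'] // := red (~~ b) [:: Hyp (~~ b); Par b]
      [:: Par b; Par b] [:: Hyp (~~ b)] v; first by rewrite !inE negbK eqxx !orbT.
    by move: hbu; rewrite uE' /irr_head /= eqxx.
  have {}cb := negE _ _ cb.
  subst c; rewrite eqxx /=.
  case: v irrv buv cbuv uE red => [|[[] c] v] //= irrv buv cbuv uE red _.
  have [cb|cb] := eqVneq c b; first subst c.
    have [|||n uE'] // := red (~~ b) [:: Hyp (~~ b); Par (~~ b); Par b]
      [:: Par b; Par (~~ b)] [:: Hyp b] v;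
      first by rewrite !inE negbK eqxx !orbT.
    by move: hbu; rewrite uE' /irr_head /= eqxx.
  have {}cb := negE _ _ cb.
  have [|||n uE'] // := red (~~ b) [:: Hyp (~~ b); Par (~~ b); Par (~~ b)]
    [:: Par (~~ b)] [:: Hyp (~~ b)] v; first by rewrite !inE eqxx !orbT.
    by rewrite cb.
  by move: hbu; rewrite uE' /irr_head /=; case: (b).
(* Inner induction on [u]: cancelling parabolic letters leaves the hyperbolic count unchanged. *)
move=> u v ltk irru irrv uv; have := hcount_eq irru irrv uv.
elim: u v ltk irru irrv uv => [|[[] b] u IHu] v ltk irru irrv uv.
- case: v irrv uv => [|[[] c] v] // irrv uv.
  by case: (@lft_word_Par_neq1 c v).
- by move=> _; exact: headHyp.
case: v irrv uv => [|[[] c] v] irrv uv cuv.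
- by case: (@lft_word_Par_neq1 b u).
- by apply/esym/headHyp => //; rewrite -cuv.
have bc := lft_word_Par_head uv; rewrite -{}bc in irrv uv *.
by congr (_ :: _); apply: IHu => //; exact: lft_word_cons_inj uv.
Qed.

(** * Confluence and the isomorphism *)

(** Normal forms of two descendants of a word have the same map, hence coincide; no critical pairs
    are inspected. *)
Lemma confluent_lft : confluent lft_presentation.
Proof.
move=> w w1 w2 ww1 ww2.
have [n1 irr1 wn1] := irr_normal_form w1.
have [n2 irr2 wn2] := irr_normal_form w2.
exists n1; split=> //; rewrite (@irr_uniq n1 n2) //.
by rewrite -(lft_word_steps wn1) -(lft_word_steps wn2)
  -(lft_word_steps ww1) -(lft_word_steps ww2).
Qed.

Lemma steps_word_eq (u v : word) :
  steps u v -> word_eq (P := lft_presentation) u v.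
Proof.
by elim=> {u v} [u v uv|u|u v w _ uv _ vw];
  [exact: rst_step|exact: rst_refl|exact: rst_trans uv vw].
Qed.

Lemma lft_word_eqP (u v : word) :
  lft_word u = lft_word v <-> word_eq (P := lft_presentation) u v.
Proof.
split=> [uv|]; last exact: lft_word_eq.
have [n un] := irr_normal_form u; have [m vm] := irr_normal_form v.
move=> /[dup] /steps_word_eq vm' /lft_word_steps vmE.
move=> /[dup] /steps_word_eq un' /lft_word_steps unE.
apply: rst_trans un' _; apply: rst_sym.
by rewrite (@irr_uniq n m) // -unE -vmE.
Qed.

Local Notation gens := [set lft_A R; lft_B R; lft_C2 R; lft_c2 R].

Lemma generated_lft_word (w : word) : generated gens (lft_word w).
Proof.
elim: w => [|x w IHw]; first exact: generated_one.
apply: generated_mul IHw; apply: generated_gen.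
by case: x => -[] [] /=; [right|left; right|left; left; right|left; left; left].
Qed.

Lemma generated_lft_wordP (f : selfmap (projline R)) :
  generated gens f -> exists w, lft_word w = f.
Proof.
have one x : exists w, lft_word w = lft_letter x.
  by exists [:: x]; rewrite /= mulg1.
elim=> {f} [|f|f g _ [u <-] _ [v <-]].
- by exists [::].
- by move=> [[[->|->]|->]|->]; [exact: (one (Par false))|exact: (one (Par true))
    |exact: (one (Hyp false))|exact: (one (Hyp true))].
- by exists (u ++ v); rewrite lft_word_cat.
Qed.

Lemma generated_lft_isomorphic :
  monoid_isomorphic (generated_monoid gens) (presented_monoid lft_presentation).
Proof.
have ex_w (x : generated_monoid gens) : exists w, lft_word w = val x.
  by apply/generated_lft_wordP/asboolP; exact: (valP x).
(* A chosen word for each map; its class does not depend on the choice, by [lft_word_eqP]. *)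
pose word_of x := projT1 (cid (ex_w x)).
have word_ofE x : lft_word (word_of x) = val x by exact: projT2 (cid (ex_w x)).
pose f (x : generated_monoid gens) : presented_monoid lft_presentation :=
  word_class (P := lft_presentation) (word_of x).
have f1 : f 1%g = 1%g.
  by apply/word_classP/lft_word_eqP; rewrite word_ofE.
have fM : {morph f : x y / (x * y)%g}.
  move=> x y; rewrite [RHS]word_class_cat; apply/word_classP/lft_word_eqP.
  by rewrite lft_word_cat !word_ofE.
pose f_mor := isUMagmaMorphism.Build _ _ f (f1, fM).
pose F : UMagmaMorphism.type _ _ := HB.pack f f_mor.
exists F.
have gen_repr (m : presented_monoid lft_presentation) :
    generated_pred gens (lft_word (class_repr m)).
  by apply/asboolP; exact: generated_lft_word.
pose g (m : presented_monoid lft_presentation) : generated_monoid gens :=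
  Sub (lft_word (class_repr m)) (gen_repr m).
exists g => [x|m].
  apply: val_inj; rewrite /= -word_ofE; apply/lft_word_eqP/word_classP.
  exact: class_reprK.
rewrite -[RHS]class_reprK; apply/word_classP/lft_word_eqP.
exact: word_ofE.
Qed.

End Evaluation.

Theorem mainTheorem4 (R : realType) :
  exists P : presentation,
    [/\ finite_presentation P,
        complete_presentation P
      & monoid_isomorphic
          (generated_monoid
             [set lft_A R; lft_B R; lft_C2 R; lft_c2 R])
          (presented_monoid P)].
Proof.
exists lft_presentation; split.
- exact: finite_lft_presentation.
- by split; [exact: terminating_lft|exact: (confluent_lft R)].
- exact: generated_lft_isomorphic.
Qed.
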